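(* Let $\mathcal{V}$ be a collection of closed convex sets in $\mathbb{R}^d$ and $\mathcal{U}$ the collection of complements of all sets in $\mathcal{V}$. For each $V\in\mathcal{V}$ fix a representation $$V=\bigcap_{\alpha\in A_V}H_\alpha,$$ where the $H_\alpha$ are closed halfspaces and $A_V$ is an index set. Let $$\mathcal{H}^V=\{\overline{H_\alpha^c}+x : \alpha\in A_V,\ x\in\mathbb{R}^d\}$$ be the collection of closures of complements of the halfspaces $H_\alpha$ and their translations, and let $\mathcal{H}=\bigcup_{V\in\mathcal{V}}\mathcal{H}^V$. Suppose that for every $H\in\mathcal{H}$ there exists an at most countable collection of sets $V_i\in\mathcal{V}$ such that $$V_1\subseteq V_2\subseteq\cdots\quad\text{and}\quad \mathring{H}=\bigcup_i V_i .$$ Then for every probability measure $P$ on the Borel sets of $\mathbb{R}^d$, $$D(x;P,\mathcal{U})=D(x;P,\mathcal{H})=D(x;P,\mathring{\mathcal{H}})\quad\text{for every }x\in\mathbb{R}^d,$$ where $\mathring{\mathcal{H}}=\{\mathring{H}:H\in\mathcal{H}\}$ is the family of open halfspaces from $\mathcal{H}$.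
   Context: For a collection $\mathcal{C}$ of Borel subsets of $\mathbb{R}^d$ and a probability measure $P$ on the Borel sets of $\mathbb{R}^d$, $D(x;P,\mathcal{C})=\inf\{P(C): x\in C\in\mathcal{C}\}$ for $x\in\mathbb{R}^d$, with $\inf\emptyset=+\infty$. $\mathring{H}$ is the topological interior of $H$, $\overline{A}$ the topological closure of $A$, and $A^c$ the complement of $A$. *)

(* Defs.v *)
From HB Require Import structures.
From mathcomp Require Import all_boot all_order all_algebra.
From mathcomp Require Import all_classical all_reals all_analysis.

Set Implicit Arguments.
Unset Strict Implicit.
Unset Printing Implicit Defensive.

Import Order.TTheory GRing.Theory Num.Theory.
Import numFieldNormedType.Exports.

Local Open Scope classical_set_scope.
Local Open Scope ring_scope.

Definition borelRd (R : realType) (d : nat) :=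
  g_sigma_algebraType (@open 'rV[R]_d).

(* D(x; P, C).  The infimum is taken in \bar R, where ereal_inf set0 = +oo.
   Members of C are not required to be Borel here: P (C) is only meaningful
   when they are, which is the case whenever all of them are open or closed. *)
Definition depth (R : realType) (d : nat) (P : probability (borelRd R d) R)
    (C : set (set 'rV[R]_d)) (x : 'rV[R]_d) : \bar R :=
  ereal_inf [set P B | B in [set B | C B /\ B x]].

(* The normal vector is nonzero, so set0 and setT are not halfspaces. *)
Definition closed_halfspace (R : realType) (d : nat) (H : set 'rV[R]_d) : Prop :=
  exists (a : 'rV[R]_d) (b : R),
    a != 0 /\ H = [set y | \sum_(i < d) a ord0 i * y ord0 i <= b].

Definition complements (T : Type) (V : set (set T)) : set (set T) :=
  [set ~` B | B in V].

Definition interiors (R : realType) (d : nat) (C : set (set 'rV[R]_d)) :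
    set (set 'rV[R]_d) :=
  [set interior H | H in C].

Definition translate (R : realType) (d : nat) (B : set 'rV[R]_d)
    (x : 'rV[R]_d) : set 'rV[R]_d :=
  [set y + x | y in B].

Definition opposite_halfspaces (R : realType) (d : nat) (I : Type)
    (H : I -> set 'rV[R]_d) : set (set 'rV[R]_d) :=
  [set K | exists (alpha : I) (x : 'rV[R]_d),
     K = translate (closure (~` H alpha)) x].

(* J is an arbitrary set of indices, so the chain may be finite or infinite. *)
Definition countable_increasing_union (T : Type) (V : set (set T)) (B : set T) :
    Prop :=
  exists (J : set nat) (W : nat -> set T),
    [/\ forall i, J i -> V (W i),
        forall i j, J i -> J j -> (i <= j)%N -> W i `<=` W j &
        B = \bigcup_(i in J) W i].

(* Main.v *)
Require Import Defs.
From HB Require Import structures.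
From mathcomp Require Import all_boot all_order all_algebra.
From mathcomp Require Import all_classical all_reals all_analysis.

Set Implicit Arguments.
Unset Strict Implicit.
Unset Printing Implicit Defensive.

Import Order.TTheory GRing.Theory Num.Theory.
Import numFieldNormedType.Exports.

Local Open Scope classical_set_scope.
Local Open Scope ring_scope.

(** The three depths are compared in a cycle: [interiors HH <= UU <= HH <=
interiors HH].

The first step is separation: a point outside [V] lies outside one of the
halfspaces that represent [V], and the open complement of that halfspace is a
smaller competitor than [~` V].  The third is translation: an open halfspace
containing [x] contains the closed one with the same normal whose boundary
passes through [x].

The second step, [UU <= HH], is the substantial one
([depth_complements_le_halfspace]).  Write [N] for the set of normals [a] such
that all halfspaces [{y | b <= a.y}] belong to [HH]; it suffices to bound the
depth by [P {y | a.x <= a.y}] with [a] in [N].  The sets of [VV] that increase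
to [{y | a.x < a.y}] omit [x], so by continuity of [P] from above their
complements bound the depth by [P {y | a.y <= a.x}]: this is the desired bound,
but for the wrong side of the hyperplane ([depth_complements_le_opposite]), and
[N] need not be symmetric.  Symmetry does hold in the limit.  Each member [W i]
of the chain omits [x], hence is separated from [x] by a halfspace
[{y | m.y <= c}] with normal [m] in [N], and [m] is nearly opposite to [a] for
large [i].  Reflection in [x] expresses this without a limit of normals: [W i]
lies in [{y | m.y < m.x}], so the reflection of [W i] in [x] lies in
[{y | m.x < m.y}].  The wrong-sided bound for [m] therefore bounds the depth
by the measure of the complement of the reflected [W i].  The reflected sets
increase to [{y | a.y < a.x}], and continuity from above gives
[P {y | a.x <= a.y}]. *)

(** * Halfspaces *)

Definition dotv (R : realType) (d : nat) (a y : 'rV[R]_d) : R :=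
  \sum_(i < d) a ord0 i * y ord0 i.

Lemma dotvD (R : realType) (d : nat) (a y z : 'rV[R]_d) :
  dotv a (y + z) = dotv a y + dotv a z.
Proof. by rewrite -big_split; apply: eq_bigr => i _; rewrite mxE mulrDr. Qed.

Lemma dotvZ (R : realType) (d : nat) (a y : 'rV[R]_d) (t : R) :
  dotv a (t *: y) = t * dotv a y.
Proof. by rewrite mulr_sumr; apply: eq_bigr => i _; rewrite mxE mulrCA. Qed.

Lemma dotvN (R : realType) (d : nat) (a y : 'rV[R]_d) :
  dotv a (- y) = - dotv a y.
Proof. by rewrite -scaleN1r dotvZ mulN1r. Qed.

Lemma dotNv (R : realType) (d : nat) (a y : 'rV[R]_d) :
  dotv (- a) y = - dotv a y.
Proof. by rewrite -sumrN; apply: eq_bigr => i _; rewrite mxE mulNr. Qed.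

Lemma dotvv_gt0 (R : realType) (d : nat) (a : 'rV[R]_d) :
  a != 0 -> 0 < dotv a a.
Proof.
move=> a_neq0; rewrite lt_def sumr_ge0 ?andbT => [|i _]; last exact: sqr_ge0.
apply: contra a_neq0 => /eqP aa0; apply/eqP/rowP => i; rewrite mxE.
have /(_ aa0 i isT)/eqP :
    dotv a a = 0 -> forall i, true -> a ord0 i * a ord0 i = 0.
  by apply: psumr_eq0P => j _; exact: sqr_ge0.
by rewrite mulf_eq0 orbb => /eqP.
Qed.

Lemma continuous_dotv (R : realType) (d : nat) (a : 'rV[R]_d) :
  continuous (dotv a).
Proof.
apply: continuous_big => [|i _ y]; first exact: add_continuous.
apply: (@continuousM _ _ (fun=> a ord0 i) (fun z : 'rV[R]_d => z ord0 i)).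
  exact: cst_continuous.
exact: coord_continuous.
Qed.

Lemma closed_halfspace_ge (R : realType) (d : nat) (a : 'rV[R]_d) (b : R) :
  closed [set y | b <= dotv a y].
Proof.
apply: (@preimage_closed _ _ (dotv a) [set r | b <= r]); last exact: closed_ge.
by move=> y _; exact: continuous_dotv.
Qed.

(** A boundary point is approached from inside along the normal, which is where
    [a != 0] enters. *)
Lemma closure_halfspace_gt (R : realType) (d : nat) (a : 'rV[R]_d) (b : R) :
  a != 0 -> closure [set y | b < dotv a y] = [set y | b <= dotv a y].
Proof.
move=> a_neq0; apply/seteqP; split.
  have /closure_id -> := @closed_halfspace_ge _ _ a b.
  by apply: closure_subset => y /ltW.
move=> y /= yb B By.
have yta : (y + t *: a) @[t --> 0^'+] --> y.
  apply: cvg_at_right_filter; rewrite -[X in _ --> X]addr0 -(scale0r a).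
  by apply: cvgD; [exact: cvg_cst | exact: scalel_continuous].
have [t [t_gt0 Bt]] := filter_ex (filterI (nbhs_right_gt (0 : R)) (yta _ By)).
exists (y + t *: a); split=> //=.
by rewrite dotvD dotvZ (le_lt_trans yb) // ltrDl mulr_gt0 // dotvv_gt0.
Qed.

Lemma interior_halfspace_ge (R : realType) (d : nat) (a : 'rV[R]_d) (b : R) :
  a != 0 -> [set y | b <= dotv a y]° = [set y | b < dotv a y].
Proof.
move=> a_neq0.
have -> : [set y | b <= dotv a y] = ~` [set y | - b < dotv (- a) y].
  by apply/seteqP; split=> y /=; rewrite dotNv ltrN2 leNgt => /negP.
rewrite interiorC closure_halfspace_gt ?oppr_eq0//.
by apply/seteqP; split=> y /=; rewrite dotNv lerN2 ltNge => /negP.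
Qed.

Lemma translate_halfspace_ge (R : realType) (d : nat) (a z : 'rV[R]_d) (b : R) :
  translate [set y | b <= dotv a y] z = [set y | b + dotv a z <= dotv a y].
Proof.
apply/seteqP; split=> [_ [y /= yb <-]|y /= yb]; first by rewrite dotvD lerD2r.
by exists (y - z); rewrite ?subrK//= dotvD dotvN lerBrDr.
Qed.

(** * Continuity from above along a chain *)

Lemma closed_measurable_borelRd (R : realType) (d : nat) (B : set 'rV[R]_d) :
  closed B -> measurable (B : set (borelRd R d)).
Proof.
move=> B_closed; rewrite -(setCK B); apply: measurableC.
by apply: sub_sigma_algebra; exact: closed_openC.
Qed.

(** Continuity from above for the complements of a chain indexed by an arbitrary
    set [J] of integers.  The partial unions [U n] form an honest increasing
    sequence, and each is either empty or a member of the chain.  When it is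
    empty the bound is the trivial [c <= 1], which needs [J] to be nonempty. *)
Lemma le_measure_setC_bigcup (dT : measure_display) (T : measurableType dT)
    (R : realType) (P : probability T R) (J : set nat) (W : nat -> set T)
    (c : \bar R) :
  J !=set0 -> (forall i, J i -> measurable (W i)) ->
  (forall i j, J i -> J j -> (i <= j)%N -> W i `<=` W j) ->
  (forall i, J i -> (c <= P (~` W i))%E) ->
  (c <= P (~` (\bigcup_(i in J) W i)))%E.
Proof.
move=> [j0 Jj0] W_meas W_mono c_le.
pose U n := \bigcup_(i in J `&` [set i | (i <= n)%N]) W i.
have U_cases n : U n = set0 \/ exists2 j, J j & U n = W j.
  elim: n => [|n IHn].
    have [J0|J0] := pselect (J 0%N); [right; exists 0%N => // | left].
      apply/seteqP; split=> [y [i [_ /=]]|y W0y]; last by exists 0%N.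
      by rewrite leqn0 => /eqP ->.
    apply/seteqP; split=> // y [i [Ji /=]]; rewrite leqn0 => /eqP i0.
    by rewrite i0 in Ji.
  have [Jn|Jn] := pselect (J n.+1).
    right; exists n.+1 => //.
    apply/seteqP; split=> [y [i [Ji /= le_in] Wiy]|y Wy].
      exact: W_mono Wiy.
    by exists n.+1 => //; split=> /=.
  suff -> : U n.+1 = U n by [].
  apply/seteqP; split=> y [i [Ji /= le_in] Wiy]; exists i => //; split=> //=.
    by move: le_in; rewrite leq_eqVlt => /orP[/eqP ei|//]; rewrite ei in Ji.
  exact: leqW.
have cU n : (c <= P (~` U n))%E.
  have [->|[j Jj ->]] := U_cases n; last exact: c_le.
  by rewrite setC0 probability_setT (le_trans (c_le _ Jj0)) ?probability_le1//;
    apply: measurableC; exact: W_meas.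
have U_meas n : measurable (~` U n).
  apply: measurableC; have [->|[j Jj ->]] := U_cases n => //; exact: W_meas.
have -> : ~` (\bigcup_(i in J) W i) = \bigcap_n ~` U n.
  rewrite -setC_bigcup; congr (~` _); apply/seteqP; split=> y.
    by move=> [i Ji Wiy]; exists i => //; exists i => //; split=> /=.
  by move=> [n _ [i [Ji _] Wiy]]; exists i.
have P_cvg : P (~` U n) @[n --> \oo] --> P (\bigcap_n ~` U n).
  apply: nonincreasing_cvg_mu => //.
  - by rewrite (le_lt_trans (probability_le1 _ _)) ?ltry.
  - exact: bigcap_measurable.
  - move=> n m le_nm; apply/subsetPset/subsetC => y [i [Ji /= le_in] Wiy].
    by exists i => //; split=> //=; exact: leq_trans le_nm.
rewrite -(cvg_lim _ P_cvg)//; apply: lime_ge; first exact: cvgP P_cvg.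
exact: nearW.
Qed.

(** * Depth with respect to complements *)

Lemma depth_le_measure (R : realType) (d : nat)
    (P : probability (borelRd R d) R) (C : set (set 'rV[R]_d)) (x : 'rV[R]_d)
    (B : set 'rV[R]_d) :
  C B -> B x -> (depth P C x <= P B)%E.
Proof. by move=> CB Bx; apply: ereal_inf_lbound; exists B. Qed.

(** The approximating sets lie in an open halfspace with [x] on its boundary, so
    they omit [x] and their complements are competitors for the depth; the limit
    of these complements is the halfspace on the other side. *)
Lemma depth_complements_le_opposite (R : realType) (d : nat)
    (VV : set (set 'rV[R]_d)) (a x : 'rV[R]_d)
    (P : probability (borelRd R d) R) :
  a != 0 -> (forall V, VV V -> closed V) ->
  countable_increasing_union VV [set y | dotv a x < dotv a y] ->
  (depth P (complements VV) x <= P [set y | (dotv a y <= dotv a x)%R])%E.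
Proof.
move=> a_neq0 VV_closed [J [W [VVW W_mono W_union]]].
have -> : [set y | dotv a y <= dotv a x] = ~` [set y | dotv a x < dotv a y].
  by apply/seteqP; split=> y /=; rewrite leNgt => /negP.
rewrite W_union; apply: le_measure_setC_bigcup => // [|i Ji|i Ji].
- have : [set y | dotv a x < dotv a y] (x + a).
    by rewrite /= dotvD ltrDl dotvv_gt0.
  by rewrite W_union => -[i Ji _]; exists i.
- by apply: closed_measurable_borelRd; exact: VV_closed (VVW _ Ji).
- apply: depth_le_measure; first by exists (W i) => //; exact: VVW.
  move=> Wx; have : (\bigcup_(i in J) W i) x by exists i.
  by rewrite -W_union /= ltxx.
Qed.

(** Passage to the correct side of the hyperplane.  [N] plays the role of the
    normals of the halfspaces that represent the sets of [VV]; the separating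
    normals [m] take the place of [- a], which may fail to be in [N]. *)
Lemma depth_complements_le_halfspace (R : realType) (d : nat)
    (VV : set (set 'rV[R]_d)) (N : set 'rV[R]_d) (x : 'rV[R]_d)
    (P : probability (borelRd R d) R) :
  (forall a, N a -> a != 0) -> (forall V, VV V -> closed V) ->
  (forall V, VV V -> ~ V x ->
     exists m c, [/\ N m, c < dotv m x & V `<=` [set y | dotv m y <= c]]) ->
  (forall a b, N a ->
     countable_increasing_union VV [set y | b < dotv a y]) ->
  forall a, N a ->
  (depth P (complements VV) x <= P [set y | (dotv a x <= dotv a y)%R])%E.
Proof.
move=> N_neq0 VV_closed VV_sep N_union a Na.
have [J [W [VVW W_mono W_union]]] := N_union a (dotv a x) Na.
pose s y : 'rV[R]_d := x *+ 2 - y.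
have dots m y : dotv m (s y) = dotv m x *+ 2 - dotv m y.
  by rewrite /s mulr2n !dotvD dotvN mulr2n.
have -> : [set y | dotv a x <= dotv a y] = ~` (\bigcup_(i in J) (s @^-1` W i)).
  rewrite -preimage_bigcup -W_union; apply/seteqP; split=> y /=;
    by rewrite dots mulr2n -addrA ltrDl subr_gt0 leNgt => /negP.
have Ws_closed i : J i -> closed (s @^-1` W i).
  move=> Ji; apply: preimage_closed; last exact: VV_closed (VVW _ Ji).
  move=> y _; apply: (@continuousB _ _ _ (fun=> x *+ 2) id).
    exact: cst_continuous.
  exact: cvg_id.
apply: le_measure_setC_bigcup => // [|i Ji|i j Ji Jj le_ij|i Ji].
- have : [set y | dotv a x < dotv a y] (x + a).
    by rewrite /= dotvD ltrDl dotvv_gt0 // N_neq0.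
  by rewrite W_union => -[i Ji _]; exists i.
- by apply: closed_measurable_borelRd; exact: Ws_closed.
- by apply: preimage_subset; exact: W_mono.
have Wx : ~ W i x.
  move=> Wx; have : (\bigcup_(i in J) W i) x by exists i.
  by rewrite -W_union /= ltxx.
(* The complement of [s @^-1` W i] contains [{y | m.y <= m.x}], because the
   reflection [s] in [x] reverses the inequality [m.y < m.x] valid on [W i]. *)
have [m [c [Nm c_lt W_le]]] := VV_sep _ (VVW i Ji) Wx.
apply: (le_trans (depth_complements_le_opposite P (N_neq0 m Nm) VV_closed
  (N_union m (dotv m x) Nm))).
apply: le_measure; rewrite ?inE.
- rewrite (_ : [set _ | _] = [set y | - dotv m x <= dotv (- m) y]).
    by apply: closed_measurable_borelRd; exact: closed_halfspace_ge.
  by apply/seteqP; split=> y /=; rewrite dotNv lerN2.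
- by apply: measurableC; apply: closed_measurable_borelRd; exact: Ws_closed.
move=> y /= ym Wsy; move: (le_lt_trans (W_le _ Wsy) c_lt).
by rewrite dots mulr2n -addrA gtrDl subr_lt0 ltNge ym.
Qed.

(** * Comparison of the three depths *)

Theorem theorem5p2 (R : realType) (d : nat)
  (VV : set (set 'rV[R]_d))
  (VV_closed : forall V, VV V -> closed V)
  (VV_convex : forall V, VV V -> convex_set V)
  (A : set 'rV[R]_d -> Type)
  (H : forall V : set 'rV[R]_d, A V -> set 'rV[R]_d)
  (H_halfspace : forall V, VV V -> forall alpha : A V,
     closed_halfspace (H V alpha))
  (H_repr : forall V, VV V -> V = \bigcap_(alpha in [set: A V]) H V alpha)
  (UU := complements VV)
  (HH := \bigcup_(V in VV) opposite_halfspaces (H V))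
  (H_union : forall K, HH K -> countable_increasing_union VV (interior K))
  (P : probability (borelRd R d) R) (x : 'rV[R]_d) :
  depth P UU x = depth P HH x /\ depth P HH x = depth P (interiors HH) x.
Proof.
(* [b] is arbitrary because [HH] is stable under translation. *)
pose N := [set a : 'rV[R]_d |
  a != 0 /\ forall b, HH [set y | b <= dotv a y]].
have HHP V (alpha : A V) a b : VV V -> a != 0 ->
    H V alpha = [set y | dotv a y <= b] ->
    N a /\ (forall z, translate (closure (~` H V alpha)) z =
                      [set y | b + dotv a z <= dotv a y]).
  move=> VVV a_neq0 HE.
  have closE : closure (~` H V alpha) = [set y | b <= dotv a y].
    rewrite -closure_halfspace_gt// HE; congr closure.
    by apply/seteqP; split=> y /=; rewrite ltNge => /negP.
  have trE z : translate (closure (~` H V alpha)) z =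
               [set y | b + dotv a z <= dotv a y].
    by rewrite closE translate_halfspace_ge.
  split=> //; split=> // c; exists V => //.
  (* Translating by a multiple of the normal reaches every offset [c]. *)
  exists alpha, (((c - b) / dotv a a) *: a).
  by rewrite trE dotvZ divfK ?gt_eqF ?dotvv_gt0// subrKC.
have VV_sep V : VV V -> ~ V x ->
    exists m c, [/\ N m, c < dotv m x & V `<=` [set y | dotv m y <= c]].
  move=> VVV Vx; rewrite {1}(H_repr V VVV) in Vx.
  have [alpha Hx] : exists alpha, ~ H V alpha x.
    by apply/existsNP => HVx; apply: Vx => alpha _.
  have [a [b [a_neq0 HE]]] := H_halfspace V VVV alpha.
  exists a, b; split.
  - by have [] := HHP V alpha a b VVV a_neq0 HE.
  - by move: Hx; rewrite HE ltNge => /negP.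
  - by move=> y; rewrite {1}(H_repr V VVV) => /(_ alpha I); rewrite HE.
have N_union a b : N a -> countable_increasing_union VV [set y | b < dotv a y].
  by move=> [a_neq0 /(_ b)/H_union]; rewrite interior_halfspace_ge.
have HH_N K : HH K -> exists a b, N a /\ K = [set y | b <= dotv a y].
  move=> [V VVV [alpha [z ->]]].
  have [a [b [a_neq0 HE]]] := H_halfspace V VVV alpha.
  have [Na trE] := HHP V alpha a b VVV a_neq0 HE.
  by exists a, (b + dotv a z).
have UU_le_HH : (depth P UU x <= depth P HH x)%E.
  apply/ereal_infP => _ [K [/HH_N[a [b [Na ->]]] /= xb] <-].
  have N_neq0 m : N m -> m != 0 by case.
  apply: le_trans
    (depth_complements_le_halfspace P N_neq0 VV_closed VV_sep N_union Na) _.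
  apply: le_measure; rewrite ?inE;
    try by apply: closed_measurable_borelRd; exact: closed_halfspace_ge.
  by move=> y /=; exact: le_trans.
have HH_le_int : (depth P HH x <= depth P (interiors HH) x)%E.
  apply/ereal_infP => _ [_ [[K /HH_N[a [b [[a_neq0 aHH] ->]]] <-] xK] <-].
  move: xK; rewrite interior_halfspace_ge//= => xb.
  apply: (le_trans (depth_le_measure P (aHH (dotv a x)) (lexx _))).
  apply: le_measure; rewrite ?inE.
  - by apply: closed_measurable_borelRd; exact: closed_halfspace_ge.
  - rewrite -interior_halfspace_ge//; apply: sub_sigma_algebra.
    exact: open_interior.
  by move=> y /=; exact: lt_le_trans.
have int_le_UU : (depth P (interiors HH) x <= depth P UU x)%E.
  apply/ereal_infP => _ [_ [[V VVV <-] Vx] <-].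
  have [a [b [[a_neq0 aHH] b_lt V_le]]] := VV_sep V VVV Vx.
  have intE := interior_halfspace_ge b a_neq0.
  apply: (@le_trans _ _ (P [set y | b < dotv a y])).
    apply: depth_le_measure => //.
    by rewrite -intE; exists [set y | b <= dotv a y].
  apply: le_measure; rewrite ?inE.
  - by rewrite -intE; apply: sub_sigma_algebra; exact: open_interior.
  - apply: measurableC; apply: closed_measurable_borelRd.
    exact: VV_closed.
  - by move=> y /= by_lt /V_le /=; rewrite leNgt by_lt.
split; apply/eqP; rewrite eq_le; apply/andP; split=> //.
- exact: le_trans int_le_UU.
- exact: le_trans UU_le_HH.
Qed.
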